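(* (1) Any metric space satisfying the four-point inequality has metric type $2$ with constant $1$. In particular, every metric tree has metric type $2$ with constant $1$. (2) Any complete metric tree has metric cotype $2$, with a universal constant; that is, there is a constant $\Gamma>0$ such that every complete metric tree has metric cotype $2$ with constant $\Gamma$.
   Context: A metric segment $[x,y]$ in a metric space $M$ is the image of an isometric embedding $\gamma:[a,b]\to M$ of a real interval with $\gamma(a)=x$, $\gamma(b)=y$. A metric space $T$ is a metric tree if for all $x,y,z\in T$: (i) there is a unique metric segment $[x,y]$ from $x$ to $y$, and (ii) $[x,z]\cap[z,y]=\{z\}$ implies $[x,z]\cup[z,y]=[x,y]$. A metric space $(X,d)$ satisfies the four-point inequality if for all $x_1,x_2,x_3,x_4\in X$, $$d(x_1,x_2)+d(x_3,x_4)\le\max\{d(x_1,x_3)+d(x_2,x_4),\,d(x_1,x_4)+d(x_2,x_3)\}.$$ Metric type (Bourgain–Milman–Wolfson): for $1\le p\le 2$ and $K>0$, a metric space $(X,d)$ has metric type $p$ with constant $K$ if for every $n\in\mathbb{N}$ and every function $f:\{-1,1\}^n\to X$, $$\sum_{\varepsilon\in\{-1,1\}^n}d\big(f(\varepsilon),f(-\varepsilon)\big)^2\le K\,n^{1/p-1/2}\sum_{\varepsilon\in\{-1,1\}^n}\sum_{i=1}^n d\big(f(\varepsilon),f(\varepsilon^{[i]})\big)^2,$$ where $\varepsilon^{[i]}$ is obtained from $\varepsilon=(\varepsilon_1,\dots,\varepsilon_n)$ by changing the sign of the $i$-th coordinate. For $p=2$ the factor $n^{1/p-1/2}$ equals $1$.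 Metric cotype (Mendel–Naor): a metric space $(M,d)$ has metric cotype $q$ with constant $\Gamma$ if for every $n\in\mathbb{N}$ there is an even integer $m\ge 2$ such that for every $f:\mathbb{Z}_m^n\to M$, $$\sum_{j=1}^n\mathbb{E}_x\Big[d\big(f(x+\tfrac m2 e_j),f(x)\big)^q\Big]\le\Gamma^q m^q\,\mathbb{E}_{\varepsilon,x}\Big[d\big(f(x+\varepsilon),f(x)\big)^q\Big],$$ where $x$ is uniformly distributed in $\mathbb{Z}_m^n$, $\varepsilon$ is uniformly distributed in $\{-1,0,1\}^n$, and $e_1,\dots,e_n$ are the standard generators of $\mathbb{Z}_m^n$. *)

(* Defs.v *)
From mathcomp Require Import all_boot all_order all_algebra.
From mathcomp Require Import all_classical all_reals all_analysis.

Set Implicit Arguments.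
Unset Strict Implicit.
Unset Printing Implicit Defensive.

Import Order.TTheory GRing.Theory Num.Theory.

Local Open Scope classical_set_scope.
Local Open Scope ring_scope.

Definition metric_segment (R : realType) (M : metricType R) (x y : M)
    (S : set M) : Prop :=
  exists (a b : R) (gamma : R -> M),
    [/\ a <= b,
        {in `[a, b] &, forall s t, mdist (gamma s) (gamma t) = `|s - t|},
        gamma a = x, gamma b = y
      & S = gamma @` [set` `[a, b]] ].

Definition metric_tree (R : realType) (T : metricType R) : Prop :=
  (forall x y : T, exists! S : set T, metric_segment x y S) /\
  (forall (x y z : T) (Sxz Szy Sxy : set T),
     metric_segment x z Sxz -> metric_segment z y Szy ->
     metric_segment x y Sxy ->
     Sxz `&` Szy = [set z] -> Sxz `|` Szy = Sxy).

(* The library's completeType is restricted to pointed spaces. *)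
Definition complete_metric (R : realType) (M : metricType R) : Prop :=
  forall u : nat -> M, cauchy (u @ \oo) -> exists l : M, u @ \oo --> l.

Definition four_point (R : realType) (X : metricType R) : Prop :=
  forall x1 x2 x3 x4 : X,
    mdist x1 x2 + mdist x3 x4 <=
      Num.max (mdist x1 x3 + mdist x2 x4) (mdist x1 x4 + mdist x2 x3).

(* The cube {-1, 1}^n, the sign (-1) ^+ b being encoded by the boolean b. *)
Definition cube (n : nat) : finType := {ffun 'I_n -> bool}.

Definition cube_opp (n : nat) (e : cube n) : cube n := [ffun i => ~~ e i].

Definition cube_flip (n : nat) (i : 'I_n) (e : cube n) : cube n :=
  [ffun k => if k == i then ~~ e k else e k].

Definition metric_type (R : realType) (X : metricType R) (p K : R) : Prop :=
  forall (n : nat) (f : cube n -> X),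
    \sum_(e : cube n) mdist (f e) (f (cube_opp e)) ^+ 2 <=
      K * n%:R `^ (p^-1 - 2^-1) *
      \sum_(e : cube n) \sum_(i < n) mdist (f e) (f (cube_flip i e)) ^+ 2.

Definition unif_mean (R : realType) (A : finType) (F : A -> R) : R :=
  #|A|%:R^-1 * \sum_(a : A) F a.

(* The element of (Z/m)^n induced by a vector of {-1, 0, 1}^n, a coordinate
   of which is encoded by k : 'I_3 standing for k - 1. The encoding keeps the
   law of epsilon uniform on {-1, 0, 1}^n also when m = 2, where 1 = -1. *)
Definition trit_vec (m n : nat) (e : {ffun 'I_n -> 'I_3}) : 'rV['Z_m]_n :=
  \row_i ((e i)%:R - 1).

(* 'Z_m is Z/m because m >= 2. *)
Definition metric_cotype (R : realType) (M : metricType R) (q Gamma : R)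
    : Prop :=
  forall n : nat, exists m : nat,
    [/\ (2 <= m)%N, ~~ odd m
      & forall f : 'rV['Z_m]_n -> M,
          \sum_(j < n) unif_mean (fun x : 'rV['Z_m]_n =>
             mdist (f (x + (m./2)%:R *: delta_mx 0 j)) (f x) `^ q) <=
          Gamma `^ q * m%:R `^ q *
          unif_mean (fun ex : {ffun 'I_n -> 'I_3} * 'rV['Z_m]_n =>
             mdist (f (ex.2 + trit_vec m ex.1)) (f ex.2) `^ q) ].

(* Main.v *)
(* For type 2, the four-point inequality and the triangle inequality show that
   in a quadrilateral the squares of the diagonals sum to at most the squares
   of the sides; adding coordinates one at a time to the set of flipped signs
   then gives the inequality, as in Enflo's argument. A metric tree satisfies
   the four-point inequality because two geodesics from [x] to [y] and to [z]
   share an initial segment, whose length is the Gromov product of [y] and [z].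

   For cotype 2, the four-point inequality makes a tree a CAT(0) space, so three
   points [u], [v], [w] have a barycenter [b] with
   [3 d(b,y)^2 + d(u,w)^2 / 2 <= d(u,y)^2 + d(v,y)^2 + d(w,y)^2] for all [y].
   Let [g_0 = f] and let [g_(k+1) x] be the barycenter of [g_k (x - e_k)],
   [g_k x], [g_k (x + e_k)]. Summing the barycenter inequality along [k], with
   [y = f x], bounds the sum over [k] of the mean squares of
   [d(g_k (x - e_k), g_k (x + e_k))] by a multiple of the mean square [V] of
   [d(f (x + eps), f x)], and convexity bounds the mean square of
   [d(g_k x, f x)] by a multiple of [V]. Walking from [x] to [x + (m/2) e_k] by
   steps of [2 e_k] along [g_k] costs a factor [m^2], which absorbs the error
   [n V] of replacing [f] by [g_k] as soon as [m] is of order [n]. *)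
Require Import Defs.
From mathcomp Require Import all_boot all_order all_algebra.
From mathcomp Require Import all_classical all_reals all_analysis.
From mathcomp Require Import perm ring lra.

Set Implicit Arguments.
Unset Strict Implicit.
Unset Printing Implicit Defensive.

Import Order.TTheory GRing.Theory Num.Theory.

Local Open Scope classical_set_scope.
Local Open Scope ring_scope.

(** * Betweenness and metric segments *)

Section Betweenness.
Variables (R : realType) (M : metricType R).
Implicit Types x y z p q w : M.

Definition between x p y := mdist x p + mdist p y = mdist x y.

Lemma between_sym x p y : between x p y -> between y p x.
Proof. by rewrite /between addrC !(metric_sym _ p) !(metric_sym y) (metric_sym p). Qed.

Lemma between_trans x q p y : between x p y -> between x q p -> between x q y.
Proof.
rewrite /between => xpy xqp.
have := metric_triangle x q y; have := metric_triangle q p y; lra.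
Qed.

Lemma segment_between x p y (S : set M) :
  metric_segment x y S -> S p -> between x p y.
Proof.
move=> [a [b [g [ab iso <- <- ->]]]] [s /=]; rewrite in_itv /= => /andP[as_ sb] <-.
rewrite /between !iso ?in_itv /= ?lexx ?ab ?as_ ?sb //.
rewrite !ler0_norm; lra.
Qed.

Lemma segment_endpoint x y (S : set M) : metric_segment x y S -> S y.
Proof.
by move=> [a [b [g [ab _ _ <- ->]]]]; exists b => //=; rewrite in_itv /= ab lexx.
Qed.

Lemma segment_point x y (S : set M) (s : R) :
  metric_segment x y S -> 0 <= s <= mdist x y ->
  exists2 q, between x q y & mdist x q = s.
Proof.
move=> seg; have := seg.
move=> [a [b [g [ab iso gx gy SE]]]] /andP[s0 sd].
have d : mdist x y = b - a.
  rewrite -gx -gy iso ?in_itv /= ?lexx ?ab //; rewrite ler0_norm; lra.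
have sI : a + s \in `[a, b] by rewrite in_itv /=; apply/andP; split; lra.
exists (g (a + s)).
  by apply: (segment_between seg); rewrite SE; exists (a + s).
rewrite -gx iso ?in_itv /= ?lexx ?ab //; first by rewrite ler0_norm; lra.
Qed.

(** The concatenation of the two segments has length d(x,y), so it is isometric: a shortcut between
    two of its points would bring [x] and [y] closer together. *)
Lemma segment_through x p y (S1 S2 : set M) :
  metric_segment x p S1 -> metric_segment p y S2 -> between x p y ->
  exists2 S : set M, metric_segment x y S & S p.
Proof.
move=> [a [b [g [ab iso gx gp _]]]] [c [d [h [cd iso' hp hy _]]]] xpy.
pose k s := if s <= b then g s else h (s - b + c).
have kb : k b = p by rewrite /k lexx.
have kl s : s <= b -> k s = g s by rewrite /k => ->.
have kr s : b <= s -> k s = h (s - b + c).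
  rewrite le_eqVlt => /orP[/eqP <-|bs]; first by rewrite kb subrr add0r hp.
  by rewrite /k leNgt bs.
have dxp : mdist x p = b - a.
  rewrite -gx -gp iso ?in_itv /= ?lexx ?ab //; rewrite ler0_norm; lra.
have dpy : mdist p y = d - c.
  rewrite -hp -hy iso' ?in_itv /= ?lexx ?cd //; rewrite ler0_norm; lra.
have isok s t : a <= s -> s <= t -> t <= b + (d - c) ->
    mdist (k s) (k t) = t - s.
  move=> as_ st tb; have [tb'|bt] := leP t b.
    rewrite !kl ?(le_trans st) // iso ?in_itv /= ?ler0_norm //; try lra;
      by apply/andP; split; lra.
  have [bs|sb] := leP b s.
    rewrite !kr ?(ltW bt) // iso' ?in_itv /= ?ler0_norm //; try lra;
      by apply/andP; split; lra.
  rewrite kl ?(ltW sb) // kr ?(ltW bt) //.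
  have e1 : mdist x (g s) = s - a.
    rewrite -gx iso ?in_itv /= ?lexx ?ab ?ler0_norm //; try lra;
      by apply/andP; split; lra.
  have e2 : mdist (g s) p = b - s.
    rewrite -gp iso ?in_itv /= ?lexx ?ab ?ler0_norm //; try lra;
      by apply/andP; split; lra.
  have e3 : mdist p (h (t - b + c)) = t - b.
    rewrite -hp iso' ?in_itv /= ?lexx ?cd ?ler0_norm //; try lra;
      by apply/andP; split; lra.
  have e4 : mdist (h (t - b + c)) y = d - (t - b + c).
    rewrite -hy iso' ?in_itv /= ?lexx ?cd ?ler0_norm //; try lra;
      by apply/andP; split; lra.
  have := metric_triangle (g s) p (h (t - b + c)).
  have := metric_triangle x (g s) y.
  have := metric_triangle (g s) (h (t - b + c)) y.
  by move: xpy; rewrite /between; lra.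
exists (k @` [set` `[a, b + (d - c)]]); last first.
  exists b => //; rewrite /= in_itv /=; apply/andP; split; lra.
exists a, (b + (d - c)), k; split.
- lra.
- move=> s t; rewrite !in_itv /= => /andP[as_ sb] /andP[at_ tb].
  have [st|/ltW ts] := leP s t; first by rewrite isok // ler0_norm; lra.
  by rewrite metric_sym isok // ger0_norm; lra.
- by rewrite kl.
- by rewrite kr; [rewrite -hy; congr h|]; lra.
- by [].
Qed.

End Betweenness.

(** * Metric trees and the four-point inequality *)

Section Tree.
Variables (R : realType) (T : metricType R).
Hypothesis treeT : metric_tree T.
Implicit Types x y z p q w : T.

Let seg x y : exists S : set T, metric_segment x y S.
Proof. by have [S []] := treeT.1 x y; exists S. Qed.

Lemma tree_point x y (s : R) : 0 <= s <= mdist x y ->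
  exists2 q, between x q y & mdist x q = s.
Proof. by have [S] := seg x y; exact: segment_point. Qed.

(** A point between [x] and [y] lies on a concatenated segment, and uniqueness identifies that
    segment with [S]. *)
Lemma tree_segmentE x y (S : set T) : metric_segment x y S ->
  S = [set p | between x p y].
Proof.
move=> xyS; apply/seteqP; split => p /=; first exact: segment_between.
move=> xpy; have [S1 h1] := seg x p; have [S2 h2] := seg p y.
have [S' h' S'p] := segment_through h1 h2 xpy.
have [S0 [_ uni]] := treeT.1 x y.
by rewrite -(uni _ xyS) (uni _ h').
Qed.

Lemma tree_between_inj x y p q : between x p y -> between x q y ->
  mdist x p = mdist x q -> p = q.
Proof.
move=> xpy xqy pq; have [S xyS] := seg x y; have SE := tree_segmentE xyS.
have : S p by rewrite SE.
have : S q by rewrite SE.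
have [a [b [g [ab iso gx gy SI]]]] := xyS.
rewrite SI => -[s /=]; rewrite in_itv /= => /andP[as_ sb] gs.
move=> [t /=]; rewrite in_itv /= => /andP[at_ tb] gt.
have e u : a <= u -> u <= b -> mdist x (g u) = u - a.
  move=> au ub; rewrite -gx iso ?in_itv /= ?lexx ?ab ?au ?ub //.
  by rewrite ler0_norm; lra.
move: pq; rewrite -gs -gt !e // => /addIr st.
by rewrite st.
Qed.

(* [t] is the Gromov product of [y] and [z] at [x]: up to distance [t] from [x],
   and no further, the segments from [x] to [y] and to [z] coincide. *)
Lemma tree_branch x y z : exists2 t : R,
    mdist y z = mdist x y + mdist x z - 2 * t &
    forall s, 0 <= s <= t <-> exists q,
      [/\ between x q y, between x q z & mdist x q = s].
Proof.
pose A := [set s | exists q,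
  [/\ between x q y, between x q z & mdist x q = s]].
have A0 : A 0.
  by exists x; rewrite /between mdistxx !add0r.
have ubA : ubound A (mdist x y).
  by move=> s [q [+ _ <-]]; rewrite /between; have := mdist_ge0 q y; lra.
have hA : has_sup A by split; [exists 0 | exists (mdist x y)].
set t := sup A.
have At s : A s -> s <= t by exact: sup_upper_bound.
have down s s' : A s -> 0 <= s' <= s -> A s'.
  move=> [q [xqy xqz qs]] s's; rewrite -qs in s's.
  have [q' xq'q q's] := tree_point s's.
  by exists q'; split=> //; [exact: between_trans xqy _|exact: between_trans xqz _].
have ty : t <= mdist x y by apply: ge_sup => //; exists 0.
have tz : t <= mdist x z.
  apply: ge_sup; first by exists 0.
  by move=> s [q [_ + <-]]; rewrite /between; have := mdist_ge0 q z; lra.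
have t0 : 0 <= t := At _ A0.
have [w xwy xw] : exists2 w, between x w y & mdist x w = t.
  by apply: tree_point; rewrite t0.
have [w' xwz xw'] : exists2 w', between x w' z & mdist x w' = t.
  by apply: tree_point; rewrite t0.
have close v u s : between x v u -> mdist x v = t -> forall q,
    between x q u -> mdist x q = s -> 0 <= s <= t -> mdist q v = t - s.
  move=> xvu xv q xqu xq st; rewrite -xv in st.
  have [q' xq'v q's] := tree_point st.
  have -> : q = q'.
    by apply: (tree_between_inj xqu); [exact: between_trans xvu _|rewrite xq q's].
  by move: xq'v; rewrite /between; lra.
(* The supremum is attained: a common point farther than [t - e / 2] from [x] lies within [e / 2] of
   both [w] and [w']. *)
have ww : w = w'.
  apply: mdist_positivity; apply/eqP; rewrite eq_le mdist_ge0 andbT.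
  apply/ler_addgt0Pl => e e0; rewrite addr0.
  have [s As st] := @sup_adherent _ A (e / 2) (divr_gt0 e0 (ltr0Sn R 1)) hA.
  have ts := At _ As; case: As => q [xqy xqz xq].
  have st0 : 0 <= s <= t by rewrite ts -xq mdist_ge0.
  have := close _ _ _ xwy xw _ xqy xq st0.
  have := close _ _ _ xwz xw' _ xqz xq st0.
  have := metric_triangle w q w'; rewrite (metric_sym w q) -/t in st *.
  by move: st; rewrite -/t; lra.
subst w'.
have {}At : A t by exists w.
exists t; last first.
  move=> s; split; first exact: down.
  by move=> As; have [q [_ _ qs]] := As; rewrite -{1}qs mdist_ge0 /=; apply: sup_upper_bound.
have [S1 h1] := seg y w; have [S2 h2] := seg w z; have [S h] := seg y z.
(* Another common point [q] would lie on both segments from [x] at distance [t + mdist w q], beyond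
   the supremum. The second tree axiom then puts [w] on [y,z], whence the formula for d(y,z). *)
suff : (S1 `&` S2 = [set w]).
  move=> /(treeT.2 _ _ _ _ _ _ h1 h2 h) SE.
  have : S w by rewrite -SE; left; exact: segment_endpoint h1.
  move=> /(segment_between h); move: xwy xwz; rewrite /between.
  by rewrite (metric_sym y w); lra.
rewrite (tree_segmentE h1) (tree_segmentE h2); apply/seteqP; split => q /=; last first.
  by move->; rewrite /between mdistxx addr0 add0r.
move=> [ywq wqz].
have yqw := between_sym ywq.
have xqy : between x q y /\ mdist x q = t + mdist w q.
  move: xwy yqw; rewrite /between.
  by have := metric_triangle x w q; have := metric_triangle x q y; lra.
have xqz : between x q z /\ mdist x q = t + mdist w q.
  move: xwz wqz; rewrite /between.
  by have := metric_triangle x w q; have := metric_triangle x q z; lra.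
have : A (t + mdist w q) by exists q; case: xqy; case: xqz.
move=> /(sup_upper_bound hA); rewrite -/t => wq.
apply/esym/mdist_positivity/eqP; rewrite eq_le mdist_ge0 andbT; lra.
Qed.

(** Seen from the fourth point, the claim is that the Gromov product [t12] is at least the minimum
    of [t13] and [t32]: up to that distance the three segments coincide. *)
Lemma tree_four_point : four_point T.
Proof.
move=> x1 x2 x3 x.
have [t12 d12 h12] := tree_branch x x1 x2.
have [t13 d13 h13] := tree_branch x x1 x3.
have [t32 d32 h32] := tree_branch x x3 x2.
rewrite (metric_sym x3 x) (metric_sym x2 x) (metric_sym x1 x) (metric_sym x2 x3).
suff : t13 <= t12 \/ t32 <= t12.
  by rewrite le_max => -[?|?]; apply/orP; [left|right]; lra.
have nn y z t : (forall s, 0 <= s <= t <-> exists q,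
    [/\ between x q y, between x q z & mdist x q = s]) -> 0 <= t.
  move=> h; have /h /andP[//] : exists q,
    [/\ between x q y, between x q z & mdist x q = 0].
  by exists x; rewrite /between mdistxx !add0r.
have n13 := nn _ _ _ h13; have n32 := nn _ _ _ h32.
pose s := Num.min t13 t32.
have s0 : 0 <= s by rewrite /s le_min n13.
have /h13 [q [q1 q3 qs]] : 0 <= s <= t13 by rewrite s0 ge_min lexx.
have /h32 [q' [q'3 q'2 q's]] : 0 <= s <= t32 by rewrite s0 ge_min lexx orbT.
have qq : q = q' by apply: (tree_between_inj q3 q'3); rewrite qs q's.
subst q'.
have /h12 /andP[_] : exists q, [/\ between x q x1, between x q x2 & mdist x q = s].
  by exists q.
by rewrite ge_min => /orP.
Qed.

End Tree.

(** * Four-point spaces: metric type 2 and comparison *)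

Section FourPoint.
Variables (R : realType) (X : metricType R).
Hypothesis fpX : four_point X.

(** One pair of opposite sides bounds the sum of the diagonals, and by the triangle inequality the
    other pair bounds their difference. Squaring and adding gives the claim. *)
Lemma four_point_sqr (x1 x2 x3 x4 : X) :
  mdist x1 x2 ^+ 2 + mdist x3 x4 ^+ 2 <=
  mdist x1 x3 ^+ 2 + mdist x2 x4 ^+ 2 + mdist x1 x4 ^+ 2 + mdist x2 x3 ^+ 2.
Proof.
have key (D E a b c e : R) : 0 <= D -> 0 <= E ->
    D + E <= a + c -> D - E <= b + e -> E - D <= b + e ->
    D ^+ 2 + E ^+ 2 <= a ^+ 2 + c ^+ 2 + b ^+ 2 + e ^+ 2.
  move=> D0 E0 h1 h2 h3.
  have H1 : (D + E) ^+ 2 <= (a + c) ^+ 2 by rewrite ler_sqr ?nnegrE; lra.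
  have H2 : (D - E) ^+ 2 <= (b + e) ^+ 2.
    by rewrite -(@real_normK _ (D - E)) ?num_real // ler_sqr ?nnegrE //;
      [rewrite ler_norml; apply/andP; split|]; lra.
  have := sqr_ge0 (a - c); have := sqr_ge0 (b - e); lra.
have := fpX x1 x2 x3 x4; rewrite le_max => /orP[h|h].
  apply: key; rewrite ?mdist_ge0 //.
    have := metric_triangle x1 x4 x2; have := metric_triangle x4 x3 x2.
    by rewrite (metric_sym x4 x3) (metric_sym x3 x2); lra.
  have := metric_triangle x3 x2 x4; have := metric_triangle x2 x1 x4.
  by rewrite (metric_sym x3 x2) (metric_sym x2 x1); lra.
rewrite -addrA [leRHS]addrC addrA; apply: key; rewrite ?mdist_ge0 //.
  have := metric_triangle x1 x3 x2; have := metric_triangle x3 x4 x2.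
  by rewrite (metric_sym x4 x2); lra.
have := metric_triangle x3 x1 x4; have := metric_triangle x1 x2 x4.
by rewrite (metric_sym x3 x1); lra.
Qed.

(* The CAT(0) comparison inequality. *)
Lemma four_point_between (a b p y : X) (t : R) : 0 <= t <= 1 ->
  mdist a p = t * mdist a b -> mdist p b = (1 - t) * mdist a b ->
  mdist p y ^+ 2 <= (1 - t) * mdist a y ^+ 2 + t * mdist b y ^+ 2
                    - t * (1 - t) * mdist a b ^+ 2.
Proof.
(* [L], [A], [B] stand for d(a,b), d(a,y), d(b,y). One alternative of the four-point inequality is
   the bound on [d]; the other is the same with [a] and [b] exchanged and [t] replaced by
   [1 - t]. *)
have key (s L A B d : R) : 0 <= s <= 1 -> 0 <= d -> A <= L + B -> B <= L + A ->
    L <= A + B -> d <= B - (1 - s) * L ->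
    d ^+ 2 <= (1 - s) * A ^+ 2 + s * B ^+ 2 - s * (1 - s) * L ^+ 2.
  move=> /andP[s0 s1] d0 h1 h2 h3 hd.
  have H : d ^+ 2 <= (B - (1 - s) * L) ^+ 2 by rewrite ler_sqr ?nnegrE //; lra.
  apply: le_trans H _; rewrite -subr_ge0.
  have -> : (1 - s) * A ^+ 2 + s * B ^+ 2 - s * (1 - s) * L ^+ 2 -
    (B - (1 - s) * L) ^+ 2 = (1 - s) * ((A - (L - B)) * (A + (L - B))) by ring.
  by apply: mulr_ge0; [|apply: mulr_ge0]; lra.
move=> t01 ap pb.
have := metric_triangle a b y; have := metric_triangle b a y.
have := metric_triangle a y b; rewrite (metric_sym b a) (metric_sym y b).
have := mdist_ge0 p y.
have := fpX p y a b; rewrite le_max (metric_sym p a) ap pb.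
rewrite (metric_sym y a) (metric_sym y b).
case/orP => h d0 h1 h2 h3; first by apply: key => //; lra.
have /andP[t0 t1] := t01.
suff : mdist p y ^+ 2 <= (1 - (1 - t)) * mdist b y ^+ 2 +
  (1 - t) * mdist a y ^+ 2 - (1 - t) * (1 - (1 - t)) * mdist a b ^+ 2 by lra.
by apply: key; rewrite ?mdist_ge0 //; [apply/andP; split|..]; lra.
Qed.

Definition cube_flips (n : nat) (S : {set 'I_n}) (e : cube n) : cube n :=
  [ffun k => if k \in S then ~~ e k else e k].

Lemma cube_flipsK n (S : {set 'I_n}) : involutive (cube_flips S).
Proof. by move=> e; apply/ffunP => k; rewrite !ffunE; case: (_ \in _); rewrite ?negbK. Qed.

Lemma cube_flipK n (i : 'I_n) : involutive (cube_flip i).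
Proof. by move=> e; apply/ffunP => k; rewrite !ffunE; case: eqP; rewrite ?negbK. Qed.

(** Induction on [S], removing [i]: the quadrilateral has diagonals from [e] to its [S]-flip and
    from its [S']-flip to its [i]-flip. Summed over [e], the two diagonals agree and so do opposite
    sides, so the inequality is twice the one wanted. *)
Lemma four_point_cube_flips n (f : cube n -> X) (S : {set 'I_n}) :
  \sum_e mdist (f e) (f (cube_flips S e)) ^+ 2 <=
  \sum_(i in S) \sum_e mdist (f e) (f (cube_flip i e)) ^+ 2.
Proof.
have [k] := ubnP #|S|; elim: k S => // k IH S.
have [-> _|[i iS]] := set_0Vmem S.
  rewrite big_set0 big1 // => e _; have -> : cube_flips finset.set0 e = e.
    by apply/ffunP => k'; rewrite ffunE inE.
  by rewrite mdistxx expr0n.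
rewrite (cardsD1 i) iS ltnS => /IH {}IH.
set S' := S :\ i in IH *.
rewrite (big_setD1 i iS) /=.
have SE e : cube_flips S e = cube_flip i (cube_flips S' e).
  apply/ffunP => k'; rewrite !ffunE !inE; case: eqVneq => [->|//].
  by rewrite iS.
have com e : cube_flips S' (cube_flip i e) = cube_flips S e.
  apply/ffunP => k'; rewrite !ffunE !inE; case: eqVneq => [->|//].
  by rewrite iS.
pose F (u v : cube n -> cube n) := \sum_e mdist (f (u e)) (f (v e)) ^+ 2.
have re u v w : involutive w -> F (u \o w) (v \o w) = F u v.
  by move=> /inv_inj wi; rewrite /F [RHS](reindex_inj wi).
have Fsym u v : F u v = F v u.
  by apply: eq_bigr => e _; rewrite metric_sym.
have h : F id (cube_flips S) + F (cube_flips S') (cube_flip i) <=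
    F id (cube_flips S') + F (cube_flips S) (cube_flip i) +
    F id (cube_flip i) + F (cube_flips S) (cube_flips S').
  rewrite -!big_split; apply: ler_sum => e _ /=.
  exact: four_point_sqr.
have e1 : F (cube_flips S') (cube_flip i) = F id (cube_flips S).
  rewrite -[RHS](re _ _ (cube_flip i)); last exact: cube_flipK.
  rewrite Fsym; apply: eq_bigr => e _ /=; do 3 f_equal.
  apply/ffunP => k'; rewrite !ffunE !inE; case: eqVneq => [->|//].
  by rewrite iS /= negbK.
have e2 : F (cube_flips S) (cube_flip i) = F id (cube_flips S').
  rewrite -[RHS](re _ _ (cube_flip i)); last exact: cube_flipK.
  by rewrite Fsym; apply: eq_bigr => e _ /=; rewrite com.
have e3 : F (cube_flips S) (cube_flips S') = F id (cube_flip i).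
  rewrite -[RHS](re _ _ (cube_flips S')); last exact: cube_flipsK.
  by rewrite Fsym; apply: eq_bigr => e _ /=; rewrite SE.
rewrite e1 e2 e3 in h.
apply: (@le_trans _ _ (F id (cube_flip i) + F id (cube_flips S'))).
  by rewrite -/(F id _); lra.
by rewrite lerD2l.
Qed.

Lemma four_point_metric_type : metric_type X 2 1.
Proof.
move=> n f; rewrite subrr powRr0 !mul1r exchange_big /=.
have := four_point_cube_flips f finset.setT.
rewrite [leRHS](eq_bigl xpredT) => [|i]; last by rewrite inE.
apply: le_trans; apply: ler_sum => e _; rewrite le_eqVlt; apply/orP; left.
apply/eqP; do 3 f_equal.
by apply/ffunP => k; rewrite !ffunE inE.
Qed.

End FourPoint.

(** * Barycenters of three points *)

Section Barycenter.
Variables (R : realType) (M : metricType R).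

(** A variance inequality with equal weights; of the mutual distances only d(u,w) is kept, as it
    becomes the gradient of a smoothing step. *)
Definition barycentric (bary : M -> M -> M -> M) := forall u v w y,
  3 * mdist (bary u v w) y ^+ 2 + 2^-1 * mdist u w ^+ 2 <=
  mdist u y ^+ 2 + mdist v y ^+ 2 + mdist w y ^+ 2.

Lemma four_point_barycentric : four_point M ->
  (forall (x y : M) (s : R), 0 <= s <= mdist x y ->
    exists2 q, between x q y & mdist x q = s) ->
  exists bary, barycentric bary.
Proof.
move=> fpM geo.
have dist_between t (x y : M) : 0 <= t <= 1 -> exists q, forall z,
    mdist q z ^+ 2 <= (1 - t) * mdist x z ^+ 2 + t * mdist y z ^+ 2
                    - t * (1 - t) * mdist x y ^+ 2.
  move=> t01; have /andP[t0 t1] := t01; have [|q xqy xq] := geo x y (t * mdist x y).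
    by rewrite mulr_ge0 ?mdist_ge0 //= ler_piMl ?mdist_ge0.
  exists q => z; apply: four_point_between => //.
  by move: xqy; rewrite /between; lra.
have ex (uvw : M * M * M) : exists b, forall y,
    3 * mdist b y ^+ 2 + 2^-1 * mdist uvw.1.1 uvw.2 ^+ 2 <=
    mdist uvw.1.1 y ^+ 2 + mdist uvw.1.2 y ^+ 2 + mdist uvw.2 y ^+ 2.
  case: uvw => -[u v] w /=.
  (* As in a Euclidean triangle, [b] lies two thirds of the way along the median from [v] to the
     midpoint [p] of [u] and [w]. *)
  have [|p pP] := @dist_between 2^-1 u w; first by apply/andP; split; lra.
  have [|b bP] := @dist_between (2 / 3) v p; first by apply/andP; split; lra.
  exists b => y; have := pP y; have := bP y; have := sqr_ge0 (mdist v p); lra.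
have [b bP] := choice ex.
by exists (fun u v w => b (u, v, w)) => u v w y; exact: (bP (u, v, w)).
Qed.

End Barycenter.

(** * Walks in a finite abelian group *)

Section Walk.
Variables (R : realType) (M : metricType R) (V : finZmodType) (g : V -> M).

(** Cauchy-Schwarz along [k] steps, each step having the same sum by translation invariance. *)
Lemma sum_mdist_walk (h : V) (k : nat) :
  \sum_x mdist (g (x + h *+ k)) (g x) ^+ 2 <=
  k%:R ^+ 2 * \sum_x mdist (g (x + h)) (g x) ^+ 2.
Proof.
elim: k => [|k IH].
- rewrite expr0n mul0r big1 // => x _.
  by rewrite mulr0n addr0 mdistxx expr0n.
have [->|k0] := posnP k; first by rewrite expr1n mul1r.
set S1 := \sum_x mdist (g (x + h)) _ ^+ 2 in IH *.
have K0 : 0 < k%:R :> R by rewrite ltr0n.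
rewrite -(ler_pM2l K0).
have le1 : k%:R * \sum_x mdist (g (x + h *+ k.+1)) (g x) ^+ 2 <=
    k.+1%:R * \sum_x mdist (g (x + h *+ k)) (g x) ^+ 2 +
    k%:R * k.+1%:R * \sum_x mdist (g (x + h *+ k + h)) (g (x + h *+ k)) ^+ 2.
  rewrite !mulr_sumr -big_split /=; apply: ler_sum => x _.
  rewrite [h *+ k.+1]mulrSr addrA.
  have := metric_triangle (g (x + h *+ k + h)) (g (x + h *+ k)) (g x).
  set a := mdist _ (g x); set b := mdist _ (g x); set c := mdist _ _ => abc.
  have H : a ^+ 2 <= (c + b) ^+ 2.
    by rewrite ler_sqr ?nnegrE ?addr_ge0 ?mdist_ge0.
  (* The square (b - k c)^2 is the gap in k (b + c)^2 <= (k + 1) b^2 + k (k + 1) c^2. *)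
  have := ler_wpM2l (ltW K0) H; have := sqr_ge0 (b - k%:R * c).
  rewrite -natr1; lra.
apply: le_trans le1 _.
have -> : \sum_x mdist (g (x + h *+ k + h)) (g (x + h *+ k)) ^+ 2 = S1.
  by rewrite /S1 [RHS](reindex_inj (addIr (h *+ k))).
have := ler_wpM2l (ler0n R k.+1) IH.
rewrite -natr1; lra.
Qed.

End Walk.

(** * Uniform vectors in {-1, 0, 1}^n *)

Section Trits.
Variables (m n : nat).
Implicit Types (e : {ffun 'I_n -> 'I_3}) (k : 'I_n) (t : 'I_3).

Definition trit_set e k t : {ffun 'I_n -> 'I_3} :=
  [ffun i => if i == k then t else e i].

(** [P] ranges over predicates on [nat] so that [leq k] and [gtn k] select the coordinates from [k]
    on and those below [k]. *)
Definition trit_restr (P : pred nat) e : 'rV['Z_m]_n :=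
  \row_i (if P i then (e i)%:R - 1 else 0).

Definition dir (k : nat) : 'rV['Z_m]_n := \row_i (i == k :> nat)%:R.

(** Resampling one coordinate preserves the uniform law: adding a fixed [s] to it is a bijection. *)
Lemma sum_trit_set (R : nmodType) k (H : {ffun 'I_n -> 'I_3} -> R) :
  \sum_e \sum_t H (trit_set e k t) = (\sum_e H e) *+ 3.
Proof.
transitivity (\sum_e \sum_s H (trit_set e k (e k + s))).
  by apply: eq_bigr => e _; rewrite (reindex_inj (addrI (e k))).
have <- : \sum_(s : 'I_3) \sum_e H e = (\sum_e H e) *+ 3 by rewrite sumr_const card_ord.
rewrite exchange_big /=.
apply: eq_bigr => s _.
have inj : injective (fun e => trit_set e k (e k + s)).
  move=> e e' /ffunP ee; apply/ffunP => i; have := ee i; rewrite !ffunE.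
  by case: eqVneq => [->|_ //]; exact: addIr.
by rewrite [RHS](reindex_inj inj).
Qed.

Lemma trit_restr_set (P Q : pred nat) k e t : P k -> ~~ Q k ->
  (forall i, i != k -> P i = Q i) ->
  trit_restr P (trit_set e k t) = trit_restr Q e + (t%:R - 1) *: dir k.
Proof.
move=> Pk Qk PQ; apply/rowP => i; rewrite !mxE !ffunE.
have [->|ik] := eqVneq i k; first by rewrite Pk (negPf Qk) eqxx mulr1 add0r.
by rewrite PQ // (negPf (ik : i != k :> nat)) mulr0 addr0.
Qed.

(** With trits centred this reads -1 = 0 + (-1), 0 = -1 + 1, 1 = 1 + 0; as an identity of integers
    it holds modulo every [m]. *)
Lemma trit_orthomorphism :
  exists s1 s2 : {perm 'I_3}, forall t, (s1 t + s2 t = t + 1 :> nat)%N.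
Proof.
exists (tperm 0 1), (tperm 1 2%:R) => t.
by case: t => -[|[|[|//]]] it; rewrite !permE /=.
Qed.

(* Cancelling the coordinates outside [P] by opposite steps, and writing the
   others as differences of trits via [trit_orthomorphism], both summands are
   again uniformly distributed. *)
Lemma trit_restr_split (P : pred nat) :
  exists s1 s2 : {ffun 'I_n -> 'I_3} -> {ffun 'I_n -> 'I_3},
  [/\ injective s1, injective s2 &
      forall e, trit_restr P e = trit_vec m (s1 e) + trit_vec m (s2 e)].
Proof.
have [p1 [p2 p12]] := trit_orthomorphism.
exists (fun e => [ffun i : 'I_n => if P i then p1 (e i) else e i]).
(* [rev_ord] sends a trit [t] to [2 - t], which is negation once centred. *)
exists (fun e => [ffun i : 'I_n => if P i then p2 (e i) else rev_ord (e i)]).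
split.
- move=> e e' /ffunP ee; apply/ffunP => i; have := ee i; rewrite !ffunE.
  by case: (P i) => // /perm_inj.
- move=> e e' /ffunP ee; apply/ffunP => i; have := ee i; rewrite !ffunE.
  by case: (P i) => [/perm_inj|/rev_ord_inj].
move=> e; apply/rowP => i; rewrite !mxE !ffunE addrACA -natrD.
case: (P i); first by rewrite p12 natrD addrA addrK.
have -> : (e i + rev_ord (e i) = 2)%N by case: (e i) => -[|[|[|]]].
by rewrite -opprD subrr.
Qed.

End Trits.

(** * Smoothing one coordinate at a time *)

Section Smoothing.
Variables (R : realType) (M : metricType R) (bary : M -> M -> M -> M).
Hypothesis baryP : barycentric bary.
Variables (m n : nat) (f : 'rV['Z_m]_n -> M).

Fixpoint smooth (k : nat) : 'rV['Z_m]_n -> M :=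
  if k is k'.+1 then
    fun x => bary (smooth k' (x - dir m n k')) (smooth k' x)
                  (smooth k' (x + dir m n k'))
  else f.

Let T := {ffun 'I_n -> 'I_3}.
(** Means are kept as unnormalised sums; [N] balances a sum over [x] alone against one over [x] and
    [e]. *)
Let N : R := #|T|%:R.

Definition variation : R :=
  \sum_x \sum_(e : T) mdist (f (x + trit_vec m e)) (f x) ^+ 2.

Definition smooth_gradient (k : nat) : R :=
  \sum_x mdist (smooth k (x - dir m n k)) (smooth k (x + dir m n k)) ^+ 2.

Lemma smooth_step k x y :
  3 * mdist (smooth k.+1 x) y ^+ 2 +
  2^-1 * mdist (smooth k (x - dir m n k)) (smooth k (x + dir m n k)) ^+ 2 <=
  \sum_(t < 3) mdist (smooth k (x + (t%:R - 1) *: dir m n k)) y ^+ 2.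
Proof.
rewrite !big_ord_recl big_ord0 /= sub0r scaleN1r subrr scale0r addr0.
rewrite [X in (X - 1) *: _](_ : _ = 1 + 1) // addrK scale1r addrA addr0.
exact: baryP.
Qed.

Lemma smooth_gradient_le : N * \sum_(0 <= k < n) smooth_gradient k <= 6 * variation.
Proof.
(* The first [k] coordinates have been averaged into [smooth k]; the others are still random. *)
pose Phi k := \sum_x \sum_(e : T)
  mdist (smooth k (x + trit_restr m (leq k) e)) (f x) ^+ 2.
have Phi0 : Phi 0%N = variation.
  apply: eq_bigr => x _; apply: eq_bigr => e _; congr (mdist (f (x + _)) _ ^+ 2).
(* Twice [smooth_step], summed: its three terms resample coordinate [k], and translating [x] removes
   the shift from the gradient. *)
have step k : (k < n)%N -> 6 * Phi k.+1 + N * smooth_gradient k <= 6 * Phi k.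
  move=> kn; pose k' := Ordinal kn.
  have -> : 6 * Phi k = 2 * (Phi k *+ 3) by rewrite -[Phi k *+ 3]mulr_natl; ring.
  rewrite /Phi -sumrMnl.
  under [in leRHS]eq_bigr do rewrite -(sum_trit_set k').
  have -> : N * smooth_gradient k = \sum_x \sum_(e : T)
      mdist (smooth k (x + trit_restr m (leq k.+1) e - dir m n k))
            (smooth k (x + trit_restr m (leq k.+1) e + dir m n k)) ^+ 2.
    rewrite exchange_big /= /N mulr_natl -sumr_const; apply: eq_bigr => e _.
    by rewrite /smooth_gradient (reindex_inj (addIr (trit_restr m (leq k.+1) e))).
  rewrite !mulr_sumr -big_split /=; apply: ler_sum => x _.
  rewrite !mulr_sumr -big_split /=; apply: ler_sum => e _.
  have restrE t : trit_restr m (leq k) (trit_set e k' t) =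
      trit_restr m (leq k.+1) e + (t%:R - 1) *: dir m n k.
    apply: (@trit_restr_set _ _ _ _ k') => /=; rewrite ?leqnn ?ltnn // => i ik.
    by rewrite [RHS]ltn_neqAle eq_sym (ik : i != k :> nat).
  under eq_bigr do rewrite restrE addrA.
  have := smooth_step k (x + trit_restr m (leq k.+1) e) (f x); lra.
have tele k : (k <= n)%N ->
    6 * Phi k + N * \sum_(0 <= i < k) smooth_gradient i <= 6 * Phi 0%N.
  elim: k => [_|k IH kn]; first by rewrite big_geq // mulr0 addr0.
  rewrite big_nat_recr //= mulrDr.
  have := IH (ltnW kn); have := step k kn; lra.
rewrite -Phi0; apply: le_trans (tele n (leqnn n)).
rewrite lerDr mulr_ge0 //; apply: sumr_ge0 => x _.
by apply: sumr_ge0 => e _; exact: sqr_ge0.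
Qed.

(** Convexity: [smooth_step] without its gradient term averages one coordinate, and induction
    averages the lower ones. *)
Lemma smooth_dist k x y : (k <= n)%N ->
  N * mdist (smooth k x) y ^+ 2 <=
  \sum_(e : T) mdist (f (x + trit_restr m (gtn k) e)) y ^+ 2.
Proof.
elim: k x => [|k IH] x kn.
  rewrite /N mulr_natl -sumr_const; apply: ler_sum => e _.
  have -> : trit_restr m (gtn 0) e = 0 by apply/rowP => i; rewrite !mxE.
  by rewrite addr0.
pose k' := Ordinal kn.
rewrite -(ler_pM2l (ltr0Sn R 2)) [leRHS]mulr_natl -(sum_trit_set k').
have restrE e t : trit_restr m (gtn k.+1) (trit_set e k' t) =
    (t%:R - 1) *: dir m n k + trit_restr m (gtn k) e.
  rewrite [RHS]addrC.
  apply: (@trit_restr_set _ _ _ _ k') => /=; rewrite ?leqnn ?ltnn // => i ik.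
  by rewrite ltnS leq_eqVlt (negPf (ik : i != k :> nat)).
rewrite exchange_big /=.
apply: le_trans (_ : \sum_(t < 3)
  N * mdist (smooth k (x + (t%:R - 1) *: dir m n k)) y ^+ 2 <= _).
  rewrite -mulr_sumr mulrCA ler_wpM2l ?ler0n //.
  apply: le_trans (smooth_step k x y).
  by rewrite lerDl mulr_ge0 ?sqr_ge0 // invr_ge0 ler0n.
apply: ler_sum => t _; under eq_bigr do rewrite restrE addrA.
exact: IH (ltnW kn).
Qed.

Lemma sqr_mdist2 (x y z : M) :
  mdist x z ^+ 2 <= 2 * (mdist x y ^+ 2 + mdist y z ^+ 2).
Proof.
have : mdist x z ^+ 2 <= (mdist x y + mdist y z) ^+ 2.
  by rewrite ler_sqr ?nnegrE ?addr_ge0 ?mdist_ge0 ?metric_triangle.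
have := sqr_ge0 (mdist x y - mdist y z); lra.
Qed.

(** A restricted increment is the sum of two full ones, each contributing [variation]; squaring the
    triangle inequality costs a further factor 2. *)
Lemma variation_restr (P : pred nat) :
  \sum_x \sum_(e : T) mdist (f (x + trit_restr m P e)) (f x) ^+ 2 <=
  4 * variation.
Proof.
have [s1 [s2 [inj1 inj2 sE]]] := trit_restr_split m n P.
have V1 : variation =
    \sum_x \sum_(e : T) mdist (f (x + trit_vec m (s1 e))) (f x) ^+ 2.
  by apply: eq_bigr => x _; rewrite (reindex_inj inj1).
have V2 : variation = \sum_x \sum_(e : T)
    mdist (f (x + trit_vec m (s1 e) + trit_vec m (s2 e)))
          (f (x + trit_vec m (s1 e))) ^+ 2.
  rewrite exchange_big /= /variation exchange_big /= (reindex_inj inj2).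
  by apply: eq_bigr => e _; rewrite (reindex_inj (addIr (trit_vec m (s1 e)))).
have -> : 4 * variation = 2 * (variation + variation) by ring.
rewrite {1}V2 V1 -big_split mulr_sumr; apply: ler_sum => x _ /=.
rewrite -big_split mulr_sumr; apply: ler_sum => e _ /=.
by rewrite sE addrA; exact: sqr_mdist2.
Qed.

Lemma smooth_dist_mean k : (k <= n)%N ->
  N * \sum_x mdist (smooth k x) (f x) ^+ 2 <= 4 * variation.
Proof.
move=> kn; apply: le_trans (variation_restr (gtn k)).
by rewrite mulr_sumr; apply: ler_sum => x _; exact: smooth_dist.
Qed.

(** Pass from f(x + h) to g(x + h), g(x) and f(x): the middle leg is a walk of [K] steps, the outer
    legs cost 4 V each, and 24 = 3 (4 + 4). *)
Lemma shift_dist (j : 'I_n) (K : nat) :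
  N * \sum_x mdist (f (x + dir m n j *+ 2 *+ K)) (f x) ^+ 2 <=
  24 * variation + 3 * K%:R ^+ 2 * (N * smooth_gradient j).
Proof.
set h := dir m n j *+ 2 *+ K.
have D1 := smooth_dist_mean (ltnW (ltn_ord j)).
set g := smooth j in D1 *.
have gradE : smooth_gradient j = \sum_x mdist (g (x + dir m n j *+ 2)) (g x) ^+ 2.
  rewrite /smooth_gradient (reindex_inj (addIr (dir m n j))).
  by apply: eq_bigr => x _; rewrite /= addrK -addrA -mulr2n metric_sym.
have W := sum_mdist_walk g (dir m n j *+ 2) K; rewrite -gradE -/h in W.
have N0 : 0 <= N by exact: ler0n.
have NW := ler_wpM2l N0 W.
have D2 : \sum_x mdist (g (x + h)) (f (x + h)) ^+ 2 =
    \sum_x mdist (g x) (f x) ^+ 2.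
  by rewrite [RHS](reindex_inj (addIr h)).
suff : \sum_x mdist (f (x + h)) (f x) ^+ 2 <=
    3 * (\sum_x mdist (g (x + h)) (f (x + h)) ^+ 2 +
         \sum_x mdist (g (x + h)) (g x) ^+ 2 + \sum_x mdist (g x) (f x) ^+ 2).
  by rewrite D2 => /(ler_wpM2l N0); lra.
rewrite -!big_split mulr_sumr; apply: ler_sum => x _ /=.
have tri : mdist (f (x + h)) (f x) <=
    mdist (g (x + h)) (f (x + h)) + mdist (g (x + h)) (g x) + mdist (g x) (f x).
  rewrite (metric_sym (g (x + h)) (f _)) -addrA.
  apply: le_trans (metric_triangle _ (g (x + h)) _) _; rewrite lerD2l.
  exact: metric_triangle.
set a := mdist (g (x + h)) (f (x + h)) in tri *.
set b := mdist (g (x + h)) (g x) in tri *; set c := mdist (g x) (f x) in tri *.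
have : mdist (f (x + h)) (f x) ^+ 2 <= (a + b + c) ^+ 2.
  by rewrite ler_sqr ?nnegrE ?addr_ge0 ?mdist_ge0.
have := sqr_ge0 (a - b); have := sqr_ge0 (a - c); have := sqr_ge0 (b - c); lra.
Qed.

(** The outer legs total 24 n V, at most 24 K^2 V, and the gradients at most 3 K^2 times 6 V. *)
Lemma shift_dist_sum (K : nat) : (n <= K ^ 2)%N ->
  N * \sum_(j < n) \sum_x mdist (f (x + dir m n j *+ 2 *+ K)) (f x) ^+ 2 <=
  42 * K%:R ^+ 2 * variation.
Proof.
move=> nK; rewrite mulr_sumr.
apply: le_trans (ler_sum _ (fun j _ => shift_dist j K)) _.
rewrite big_split /= sumr_const card_ord -!mulr_sumr -(big_mkord xpredT smooth_gradient).
have V0 : 0 <= variation.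
  by apply: sumr_ge0 => x _; apply: sumr_ge0 => e _; exact: sqr_ge0.
have nK' : n%:R <= K%:R ^+ 2 :> R by rewrite -natrX ler_nat.
have := ler_wpM2r V0 nK'.
have K2 : 0 <= 3 * K%:R ^+ 2 :> R by rewrite mulr_ge0 ?sqr_ge0.
have := ler_wpM2l K2 smooth_gradient_le.
rewrite -[_ *+ n]mulr_natl; lra.
Qed.

End Smoothing.

(** * Metric cotype 2 and the theorem *)

Lemma barycentric_cotype (R : realType) (M : metricType R) bary :
  @barycentric R M bary -> metric_cotype M 2 2.
Proof.
(* With m = 4 K, the shift by m/2 is [K] steps of length 2; K = n + 1 is positive even for n = 0 and
   satisfies n <= K^2. *)
move=> baryP n; pose K := n.+1; exists (4 * K)%N; split; [by rewrite mulnS|by rewrite oddM|].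
set m := (4 * K)%N => f.
have sqr (x y : M) : mdist x y `^ 2 = mdist x y ^+ 2.
  by rewrite powR_mulrn ?mdist_ge0.
have half : m./2 = (2 * K)%N by rewrite /m (_ : 4 * K = (2 * K).*2)%N ?doubleK // -mul2n mulnA.
have nK : (n <= K ^ 2)%N by rewrite -mulnn (leq_trans (leqnSn n)) ?leq_pmulr.
have := shift_dist_sum baryP f nK.
set N := #|_|%:R; set S := \sum_(j < n) _ => NS.
have N0 : 0 < N by rewrite ltr0n; apply/card_gt0P; exists [ffun=> 0].
rewrite /unif_mean; under eq_bigr do under eq_bigr do rewrite sqr.
rewrite -mulr_sumr; under [in leRHS]eq_bigr do rewrite sqr.
have -> : \sum_(j < n) \sum_x mdist (f (x + (m./2)%:R *: delta_mx 0 j)) (f x) ^+ 2 = S.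
  apply: eq_bigr => j _; apply: eq_bigr => x _; congr (mdist (f (x + _)) _ ^+ 2).
  rewrite half -mulrnA scaler_nat; congr (_ *+ _).
  by apply/rowP => i; rewrite !mxE eqxx.
have -> : \sum_(a : {ffun 'I_n -> 'I_3} * 'rV['Z_m]_n)
    mdist (f (a.2 + trit_vec m a.1)) (f a.2) ^+ 2 = variation f.
  rewrite /variation exchange_big pair_big /=; exact: eq_bigr.
rewrite card_prod natrM -/N invfM !powR_mulrn ?ler0n //.
set c := #|_|%:R^-1; set V := variation f in NS *.
have V0 : 0 <= V.
  by apply: sumr_ge0 => x _; apply: sumr_ge0 => e _; exact: sqr_ge0.
have -> : 2 ^+ 2 * m%:R ^+ 2 * (N^-1 * c * V) = c * (2 ^+ 2 * m%:R ^+ 2 * V / N).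
  by ring.
apply: ler_wpM2l; first by rewrite invr_ge0 ler0n.
rewrite ler_pdivlMr // mulrC; apply: le_trans NS _.
(* Here 2^2 m^2 = 64 K^2 exceeds 42 K^2. *)
apply: ler_wpM2r => //; rewrite natrM.
have := sqr_ge0 (K%:R : R); lra.
Qed.

Theorem theorem5p4 (R : realType) :
  ((forall X : metricType R, four_point X -> metric_type X 2 1) /\
   (forall T : metricType R, metric_tree T -> metric_type T 2 1)) /\
  (exists Gamma : R, 0 < Gamma /\
     forall T : metricType R, metric_tree T -> complete_metric T ->
       metric_cotype T 2 Gamma).
Proof.
split; first split.
- by move=> X; exact: four_point_metric_type.
- by move=> T treeT; apply: four_point_metric_type; exact: tree_four_point.
exists 2; split=> // T treeT _.
have [bary baryP] := four_point_barycentric (tree_four_point treeT) (tree_point treeT).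
exact: barycentric_cotype baryP.
Qed.
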